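(* (1) For every ultrafilter $U$ on $\mathbb{N}^*$, there exists one and only one sequence $(\varphi_p)$, where $p$ runs over the increasing sequence of all primes and $\varphi_p$ is a mapping from $\mathbb{N}^*$ into $\{0,\dots,p-1\}$, such that $U$ contains the family of subsets of $\mathbb{N}^*$ characteristic of $(\varphi_p)$. (2) For every sequence $(\varphi_p)$, where $p$ runs over the increasing sequence of prime numbers and $\varphi_p$ is a mapping from $\mathbb{N}^*$ into $\{0,\dots,p-1\}$, there exists a non principal ultrafilter $U$ on $\mathbb{N}^*$ containing the family of subsets of $\mathbb{N}^*$ characteristic of $(\varphi_p)$.
   Context: $\mathbb{N}^*$ is the set of positive integers. For a sequence $(\varphi_p)_{p\text{ prime}}$ of maps $\varphi_p:\mathbb{N}^*\to\{0,\dots,p-1\}$, a prime $p$ and $n\in\mathbb{N}^*$, put $$N_{p^n,\varphi_p}=p^n\mathbb{N}^*-\Big(\sum_{k=1}^n p^{k-1}\varphi_p(k)\Big)=\Big\{p^nm-\sum_{k=1}^np^{k-1}\varphi_p(k): m\in\mathbb{N}^*\Big\}\subseteq\mathbb{N}^*.$$ The set of all $N_{p^n,\varphi_p}$ ($p$ prime, $n\in\mathbb{N}^*$) is called the family of subsets of $\mathbb{N}^*$ characteristic of $(\varphi_p)$. ''$U$ contains the family'' means that every member of the family belongs to $U$. *)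

(* Defs.v *)
From HB Require Import structures.
From mathcomp Require Import all_boot.
From mathcomp Require Import boolp classical_sets filter.

Set Implicit Arguments.
Unset Strict Implicit.
Unset Printing Implicit Defensive.

Local Open Scope classical_set_scope.

Definition posnat : Type := {n : nat | 0 < n}.

Definition primenat : Type := {p : nat | prime p}.

Definition succ_pos (i : nat) : posnat := exist _ i.+1 (ltn0Sn i).

Definition digit_seq : Type := forall p : primenat, posnat -> 'I_(val p).

(* sum_{k=1}^n p^(k-1) f(k), summed over i = k - 1. *)
Definition digit_sum (p n : nat) (f : posnat -> 'I_p) : nat :=
  \sum_(i < n) p ^ i * f (succ_pos i).

Lemma digit_sum_lt (p n : nat) (f : posnat -> 'I_p) : digit_sum n f < p ^ n.
Proof.
have p_gt0 : 0 < p by case: (f (succ_pos 0)) => i; apply: leq_ltn_trans.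
rewrite /digit_sum; elim: n => [|n IHn]; first by rewrite big_ord0 expn0.
rewrite big_ord_recr /= expnSr.
apply: (@leq_trans (p ^ n + p ^ n * f (succ_pos n))); first by rewrite ltn_add2r.
by rewrite -mulnS leq_pmul2l ?expn_gt0 ?p_gt0.
Qed.

(* p^n m - sum_{k=1}^n p^(k-1) f(k) as an element of N^*; by digit_sum_lt the
   natural-number subtraction is never truncated. *)
Lemma char_elt_gt0 (p n : nat) (f : posnat -> 'I_p) (m : posnat) :
  0 < p ^ n * val m - digit_sum n f.
Proof.
rewrite subn_gt0; apply: (leq_trans (digit_sum_lt n f)).
by apply: leq_pmulr; exact: (valP m).
Qed.

Definition char_elt (p n : nat) (f : posnat -> 'I_p) (m : posnat) : posnat :=
  exist _ (p ^ n * val m - digit_sum n f) (char_elt_gt0 n f m).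

Definition char_set (p n : nat) (f : posnat -> 'I_p) : set posnat :=
  range (char_elt n f).

Definition char_family (phi : digit_seq) : set_system posnat :=
  [set N | exists p : primenat, exists n : posnat,
     N = char_set (val n) (phi p)].

Definition principal (T : Type) (U : set_system T) : Prop :=
  exists x : T, U = principal_filter x.

(* Main.v *)
(** The set attached to p^n is the set of x with p^n | x + r, where r < p^n has
base-p digits phi_p(1), ..., phi_p(n): one residue class modulo p^n.  An
ultrafilter contains exactly one residue class modulo each p^n, and these are
compatible as n grows, so they determine one digit sequence for each p.
Conversely the Chinese remainder theorem yields for every N some y_N >= N lying
in the classes modulo p^N for all primes p <= N; any ultrafilter finer than the
image of the Frechet filter under y contains the family, and it is not
principal because y tends to infinity. *)

Require Import Defs.
From mathcomp Require Import all_boot.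
From mathcomp Require Import boolp classical_sets filter.

Set Implicit Arguments.
Unset Strict Implicit.
Unset Printing Implicit Defensive.

Local Open Scope classical_set_scope.

(** Since [x] is positive, the quotient of [val x + digit_sum n f] by [p ^ n] cannot be zero, so
    divisibility alone supplies the positive multiplier [m]. *)
Lemma char_setE p n (f : posnat -> 'I_p) (x : posnat) :
  char_set n f x <-> p ^ n %| val x + digit_sum n f.
Proof.
split=> [[m _ <-]|/dvdnP[m xE]].
  rewrite /= subnK ?dvdn_mulr //.
  by rewrite ltnW // -subn_gt0 (char_elt_gt0 n f m).
have m_gt0 : 0 < m.
  by case: m xE => // /eqP; rewrite addn_eq0 -leqn0 leqNgt (valP x).
exists (exist _ m m_gt0) => //; apply: val_inj => /=.
by rewrite mulnC -xE addnK.
Qed.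

Lemma digit_sumS p n (f : posnat -> 'I_p) :
  digit_sum n.+1 f = digit_sum n f + p ^ n * f (succ_pos n).
Proof. by rewrite /digit_sum big_ord_recr. Qed.

Lemma digit_sum_mod p m n (f : posnat -> 'I_p) :
  m <= n -> digit_sum n f = digit_sum m f %[mod p ^ m].
Proof.
move=> /subnK <-; elim: (n - m) => // k IHk.
by rewrite addSn digit_sumS -modnDmr expnD mulnAC modnMl addn0.
Qed.

Lemma char_set_antitone p m n (f : posnat -> 'I_p) :
  m <= n -> char_set n f `<=` char_set m f.
Proof.
move=> le_mn x /char_setE xn; apply/char_setE.
rewrite /dvdn -modnDmr -(digit_sum_mod f le_mn) modnDmr.
exact: dvdn_trans (dvdn_exp2l p le_mn) xn.
Qed.

Lemma dvdn_add_mod q x a b : q %| x + a -> q %| x + b -> a = b %[mod q].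
Proof.
move=> qa qb; apply/eqP; rewrite -(eqn_modDl x).
by move: qa qb => /eqP -> /eqP ->.
Qed.

Lemma succ_pos_val (n : posnat) : succ_pos (val n).-1 = n.
Proof. by apply: val_inj; rewrite /= prednK // (valP n). Qed.

Lemma digit_sum_inj p (f g : posnat -> 'I_p) :
  (forall n, digit_sum n f = digit_sum n g) -> f = g.
Proof.
move=> fg; apply: funext => n; apply: val_inj; rewrite -(succ_pos_val n).
have p_gt0 : 0 < p by apply: leq_ltn_trans (ltn_ord (f n)).
move: (fg (val n).-1.+1); rewrite !digit_sumS fg => /addnI/eqP.
by rewrite eqn_pmul2l ?expn_gt0 ?p_gt0 // => /eqP.
Qed.

(** A compatible sequence of residues is a [p]-adic integer. Dividing [r n.+1] by [p ^ n] leaves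
    remainder [r n], and the quotient is the next digit. *)
Lemma digit_sum_exists p (r : nat -> nat) : 0 < p ->
  (forall n, r n < p ^ n) -> (forall n, r n.+1 = r n %[mod p ^ n]) ->
  exists f : posnat -> 'I_p, forall n, digit_sum n f = r n.
Proof.
move=> p_gt0 r_lt r_mod.
have digit_lt (k : posnat) : r (val k) %/ p ^ (val k).-1 < p.
  rewrite ltn_divLR ?expn_gt0 ?p_gt0 // -expnS prednK ?(valP k) //.
exists (fun k => Ordinal (digit_lt k)); elim=> [|n IHn].
  by rewrite /digit_sum big_ord0; case: (r 0) (r_lt 0).
rewrite digit_sumS IHn /= -[r n](modn_small (r_lt n)) -r_mod addnC mulnC.
by rewrite -divn_eq.
Qed.

(** Otherwise [U] contains every complement, hence their finite intersection, which is empty because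
    the [A i] cover [T]. *)
Lemma ultra_cover (T : Type) (U : set_system T) (I : finType)
    (A : I -> set T) :
  UltraFilter U -> (forall x, exists i, A i x) -> exists i, U (A i).
Proof.
move=> UU coverA; apply: contrapT => noA.
have /filter_ex[x xA] : U (fun x => forall i, (~` A i) x).
  apply: filter_forall => i.
  by have [UA|//] := in_ultra_setVsetC (A i) UU; case: noA; exists i.
by have [i] := coverA x; apply: xA.
Qed.

Lemma ultra_residue (U : set_system posnat) q : UltraFilter U -> 0 < q ->
  exists r, r < q /\ U [set x : posnat | q %| val x + r].
Proof.
move=> UU q_gt0; have [|r Ur] := @ultra_cover _ U _
  (fun r : 'I_q => [set x : posnat | q %| val x + r]) UU; last first.
  by exists r.
(* Modulo [q], the product [val x * q.-1] represents [- val x]. *)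
move=> x; exists (Ordinal (ltn_pmod (val x * q.-1) q_gt0)) => /=.
by rewrite /dvdn modnDmr -mulnS prednK // modnMl.
Qed.

Lemma ultra_digits (U : set_system posnat) p : UltraFilter U -> 0 < p ->
  exists f : posnat -> 'I_p, forall n, U (char_set n f).
Proof.
move=> UU p_gt0.
have /choice[r rP] n : exists r, r < p ^ n /\
    U [set x : posnat | p ^ n %| val x + r].
  by apply: ultra_residue; rewrite // expn_gt0 p_gt0.
have [//|n|n|f fr] := @digit_sum_exists p r; first by have [] := rP n.
  (* Compatibility: a point common to both classes makes [r n] and [r n.+1] congruent to its
     opposite modulo [p ^ n]. *)
  have [x [/= xn xSn]] := filter_ex (filterI (rP n).2 (rP n.+1).2).
  apply: dvdn_add_mod xn; apply: dvdn_trans xSn.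
  exact: dvdn_exp2l.
exists f => n; apply: filterS (rP n).2 => x xn.
by apply/char_setE; rewrite fr.
Qed.

(** Sets of a proper filter meet, so the two digit sums are congruent modulo [p ^ n]; both are below
    [p ^ n], hence equal. *)
Lemma filter_digits_unique (U : set_system posnat) p (f g : posnat -> 'I_p) :
  ProperFilter U -> (forall n : posnat, U (char_set (val n) f)) ->
  (forall n : posnat, U (char_set (val n) g)) -> f = g.
Proof.
move=> UU Uf Ug; apply: digit_sum_inj => -[|n].
  by rewrite /digit_sum !big_ord0.
have [x [/char_setE xf /char_setE xg]] :=
  filter_ex (filterI (Uf (succ_pos n)) (Ug (succ_pos n))).
have := dvdn_add_mod xf xg.
by rewrite !modn_small // digit_sum_lt.
Qed.

Lemma chinese_seq (I : Type) (s : seq I) (m r : I -> nat) :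
  pairwise (fun i j => coprime (m i) (m j)) s ->
  exists x, all (fun i => x == r i %[mod m i]) s.
Proof.
elim: s => [|i s IHs]; first by exists 0.
rewrite pairwise_cons => /andP[co_is /IHs[x xs]].
have co : coprime (m i) (\prod_(j <- s) m j).
  by elim: s co_is {IHs xs} => [|j s IHs] /=;
    rewrite ?big_nil ?coprimen1 // big_cons coprimeMr => /andP[-> /IHs].
exists (chinese (m i) (\prod_(j <- s) m j) (r i) x).
rewrite /= chinese_modl // eqxx /=.
(* From here only [y = x] modulo the product matters: it descends to each factor [m j], so [y]
   inherits the congruences of [x]. *)
have := chinese_modr co (r i) x; move: (chinese _ _ _ _) => y {co co_is IHs}.
elim: s xs => //= j s IHs /andP[/eqP xj xs]; rewrite big_cons => yx.
have yx_dvd d : d %| m j * \prod_(i <- s) m i -> y = x %[mod d].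
  by move=> dP; rewrite -(modn_dvdm y dP) yx modn_dvdm.
by rewrite yx_dvd ?dvdn_mulr // xj eqxx IHs // yx_dvd ?dvdn_mull.
Qed.

Lemma char_set_inter_large (phi : digit_seq) N : exists x : posnat, N <= val x /\
  forall p : primenat, val p <= N -> char_set N (phi p) x.
Proof.
pose s : seq primenat := pmap insub (iota 0 N.+1).
have sP (p : primenat) : val p <= N -> p \in s.
  by move=> pN; rewrite mem_pmap_sub mem_iota.
have co_s : pairwise (fun p q : primenat => coprime (val p ^ N) (val q ^ N)) s.
  have := pmap_sub_uniq primenat (iota_uniq 0 N.+1).
  rewrite uniq_pairwise; apply: sub_pairwise => p q /= pq.
  by rewrite coprimeXl // coprimeXr // prime_coprime ?(valP p) //
    dvdn_prime2 ?(valP p) ?(valP q).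
have [x xs] := @chinese_seq _ s (fun p => val p ^ N)
  (fun p => val p ^ N - digit_sum N (phi p)) co_s.
have P_gt0 : 0 < \prod_(p <- s) val p ^ N.
  by apply: prodn_gt0 => p; rewrite expn_gt0 prime_gt0 ?(valP p).
(* Adding a multiple of all the moduli keeps the residues and pushes the solution beyond [N]. *)
pose y := x + N.+1 * \prod_(p <- s) val p ^ N.
have yN : N < y by apply: leq_trans (leq_addl _ _); rewrite leq_pmulr.
exists (exist _ y (leq_ltn_trans (leq0n N) yN)); split=> [|p pN]; first exact: ltnW.
apply/char_setE => /=; move/allP: xs => /(_ p (sP p pN)) /eqP xp.
rewrite /y addnAC dvdn_addl; last first.
  by rewrite (big_rem p) ?sP //= dvdn_mull // dvdn_mulr.
by rewrite /dvdn -modnDml xp modnDml subnK ?modnn // ltnW // digit_sum_lt.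
Qed.

Theorem proposition4p30 :
  (forall U : set_system posnat, UltraFilter U ->
     exists! phi : digit_seq, char_family phi `<=` U) /\
  (forall phi : digit_seq,
     exists U : set_system posnat,
       UltraFilter U /\ ~ principal U /\ char_family phi `<=` U).
Proof.
split=> [U UU|phi].
  have digits (p : primenat) :
      {f : posnat -> 'I_(val p) | forall n, U (char_set n f)}.
    by apply: cid; apply: ultra_digits; rewrite prime_gt0 ?(valP p).
  exists (fun p => sval (digits p)); split=> [_ [p [n ->]]|psi psiU].
    exact: (svalP (digits p)).
  apply: functional_extensionality_dep => p.
  apply: (@filter_digits_unique U) => n; first exact: (svalP (digits p)).
  by apply: psiU; exists p, n.
have /choice[y yP] := char_set_inter_large phi.
have [U [UU yU]] := ultraFilterLemma (fmap_proper_filter y eventually_filter).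
exists U; split=> //; split.
  move=> [x Ux].
  (* Since [y N] is at least [N], this tail belongs to [U]; were [U] principal at [x], the tail
     would contain [x]. *)
  have : U [set z : posnat | val x < val z].
    apply: yU; exists (val x).+1 => // N /= xN.
    by apply: leq_trans xN (yP N).1.
  by rewrite Ux => /principal_filterP /=; rewrite ltnn.
(* For such [N], the prime [p] is among those treated by [y N], and the class modulo [p ^ N] lies
   inside the one modulo [p ^ n]. *)
move=> _ [p [n ->]]; apply: yU; exists (maxn (val p) (val n)) => // N /=.
rewrite geq_max => /andP[pN nN].
by apply: (char_set_antitone nN); apply: (yP N).2.
Qed.
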